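(* Let $d\ge 2$, $0<p<s<d$. For any integer $N\ge 1$ and any $\underline m=(m^0,\dots,m^N)$ with $m^i>0$ for all $i$, the functional $\mathbf{F}_{N,\underline m}$ attains its minimum $\mu_{N,\underline m}:=\inf_{\Sigma_N}\mathbf{F}_{N,\underline m}$ on the admissible class $\Sigma_N$, and $\mu_{N,\underline m}<0$.
   Context: The discrete interaction energy is $$\mathbf{F}_{N,\underline m}(y_0,\dots,y_N):=\sum_{\substack{i,j=0\\ i\ne j}}^N\frac{m^i m^j}{|y_i-y_j|^s}-\sum_{i=1}^N\frac{m^i}{|y_i|^p},$$ where the first sum is over ordered pairs, on the admissible class $\Sigma_N:=\{(y_0,\dots,y_N)\in(\mathbb{R}^d)^{N+1}:\ y_0=0\}$, with $\mathbf{F}_{N,\underline m}=+\infty$ whenever two of the points $y_0,\dots,y_N$ coincide. *)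

(* Defs.v *)
From HB Require Import structures.
From mathcomp Require Import all_boot all_order all_algebra.
From mathcomp Require Import all_classical all_reals all_analysis.

Set Implicit Arguments.
Unset Strict Implicit.
Unset Printing Implicit Defensive.

Import Order.TTheory GRing.Theory Num.Theory.

Local Open Scope classical_set_scope.
Local Open Scope ring_scope.

(* The norm MathComp-Analysis puts on 'rV[R]_d is the sup norm, so the
   Euclidean one is spelled out. *)
Definition eucl_norm (R : realType) (d : nat) (x : 'rV[R]_d) : R :=
  Num.sqrt (\sum_(k < d) x 0 k ^+ 2).

(* Indices run over 'I_N.+1 = {0, ..., N}; the first sum is over ordered pairs,
   and 1 <= i is written i != ord0. The value +oo on coinciding points is
   needed, as division by zero returns 0. *)
Definition energy (R : realType) (d N : nat) (p s : R) (m : 'I_N.+1 -> R)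
    (y : 'I_N.+1 -> 'rV[R]_d) : \bar R :=
  if injectiveb y then
    (\sum_(i < N.+1) \sum_(j < N.+1 | i != j)
        m i * m j / eucl_norm (y i - y j) `^ s
     - \sum_(i < N.+1 | i != ord0) m i / eucl_norm (y i) `^ p)%:E
  else +oo%E.

Definition admissible (R : realType) (d N : nat) :
    set ('I_N.+1 -> 'rV[R]_d) :=
  [set y | y ord0 = 0].

Definition min_energy (R : realType) (d N : nat) (p s : R)
    (m : 'I_N.+1 -> R) : \bar R :=
  ereal_inf (energy p s m @` @admissible R d N).

(* Main.v *)
Require Import Defs.
From HB Require Import structures.
From mathcomp Require Import all_boot all_order all_algebra.
From mathcomp Require Import all_classical all_reals all_analysis.
From mathcomp Require Import lra.

(** Repulsion decays faster than attraction, since p < s. Hence points sent far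
    away from everything else, and far from each other, still gain energy from
    the charge at the origin: at scale r the gain is of order r^-p, while the
    cost is of order r^-s. Starting from the origin alone, whose energy is 0,
    this already gives a configuration of negative energy
    ([exists_energy_lt0]).

    The same remark prevents loss of compactness at infinity. Fix a ratio b and
    the radii r0 * b^k. As one of the N + 1 points is the origin, one of the
    first N + 1 shells between consecutive radii contains no point
    ([empty_shell]). The points beyond an empty shell, say at distance
    more than b * r, are pulled back to distance of order r along a
    coordinate axis, well separated from each other and from the points of
    norm at most r. If b is large, the attraction they had is at most half of
    the one they acquire, and if r0 is large the other half pays for the new
    repulsion. So every configuration can be replaced by one in a fixed ball
    without raising the energy ([descent_to_bounded]).

    Near collisions are excluded because repulsion is also the stronger
    singularity at short range: half of the repulsion, through the pairs formed
    with the origin, controls the whole attraction up to a constant, and the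
    other half blows up when two points merge. Configurations of negative energy are therefore uniformly
    separated ([energy_lt0_separated]).

    On the compact set of separated configurations in the ball the energy is
    continuous, so it has a minimizer there, and the two reductions show that it
    is a global one. *)

Set Implicit Arguments.
Unset Strict Implicit.
Unset Printing Implicit Defensive.

Import Order.TTheory GRing.Theory Num.Theory.
Import numFieldNormedType.Exports.

Local Open Scope classical_set_scope.
Local Open Scope ring_scope.

(** * Powers and their decay *)

Section powers.
Context {R : realType}.
Implicit Types a c p s t x y : R.

Lemma div_powR_le x y c p : 0 <= p -> 0 <= c -> 0 < x -> x <= y ->
  c / y `^ p <= c / x `^ p.
Proof.
move=> p0 c0 x0 xy; have y0 : 0 < y := lt_le_trans x0 xy.
rewrite ler_wpM2l// lef_pV2 ?posrE ?powR_gt0//.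
by rewrite ge0_ler_powR// nnegrE ltW.
Qed.

Lemma powR_root x p : 0 <= x -> 0 < p -> (x `^ p^-1) `^ p = x.
Proof. by move=> x0 p0; rewrite -powRrM mulVf ?gt_eqF// powRr1. Qed.

(** The bound amounts to a / c <= r^(s - p), which holds for large r because
    s - p > 0; it is what makes escaping to infinity unprofitable. *)
Lemma slow_decay_dominates a c p s : p < s -> 0 <= a -> 0 < c ->
  exists2 r0, 0 < r0 & forall r, r0 <= r -> a / r `^ s <= c / r `^ p.
Proof.
move=> ps a0 c0; have sp0 : 0 < s - p by rewrite subr_gt0.
have ac0 : 0 < a / c + 1 by rewrite ltr_wpDl// divr_ge0// ltW.
exists ((a / c + 1) `^ (s - p)^-1); first exact: powR_gt0.
move=> r r0r; have r0 : 0 < r := lt_le_trans (powR_gt0 _ ac0) r0r.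
have -> : s = (s - p) + p by rewrite subrK.
rewrite powRD ?(gt_eqF r0) ?implybT// invfM mulrA ler_wpM2r
  ?invr_ge0 ?powR_ge0//.
rewrite ler_pdivrMr ?powR_gt0// mulrC -ler_pdivrMr//.
apply: (@le_trans _ _ (a / c + 1)); first by rewrite lerDl.
rewrite -[leLHS](powR_root (ltW ac0) sp0).
by rewrite ge0_ler_powR ?nnegrE ?powR_ge0 ?(ltW r0)// ltW.
Qed.

(** Near 0 the power s dominates: t^(s - p) <= c means exactly
    t^-p <= c * t^-s. Away from 0 the left side is bounded, by its value at the
    threshold c^(1 / (s - p)). *)
Lemma singular_control c p s : 0 <= p -> p < s -> 0 < c ->
  exists C, forall t, 0 < t -> (t `^ p)^-1 <= c / t `^ s + C.
Proof.
move=> p0 ps c0; have sp0 : 0 < s - p by rewrite subr_gt0.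
have t0 : 0 < c `^ (s - p)^-1 by exact: powR_gt0.
exists (1 / (c `^ (s - p)^-1) `^ p) => t tp.
have [le_tc|gt_tc] := leP t (c `^ (s - p)^-1).
  apply: (@le_trans _ _ (c / t `^ s)); last first.
    by rewrite lerDl divr_ge0// powR_ge0.
  have -> : s = (s - p) + p by rewrite subrK.
  rewrite powRD ?(gt_eqF tp) ?implybT// invfM mulrA ler_peMl
    ?invr_ge0 ?powR_ge0//.
  rewrite ler_pdivlMr ?powR_gt0// mul1r.
  rewrite -[leRHS](powR_root (ltW c0) sp0).
  by rewrite ge0_ler_powR ?nnegrE ?powR_ge0// ltW.
rewrite -div1r ler_wpDl ?divr_ge0 ?powR_ge0 ?(ltW c0)//.
by rewrite div_powR_le// ltW.
Qed.

Lemma singular_unbounded a c s : 0 < s -> 0 < c ->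
  exists2 e, 0 < e & forall t, 0 < t -> t < e -> a <= c / t `^ s.
Proof.
move=> s0 c0; have a0 : 0 < `|a| + 1 by rewrite ltr_wpDl.
have ca0 : 0 < c / (`|a| + 1) by exact: divr_gt0.
exists ((c / (`|a| + 1)) `^ s^-1); first exact: powR_gt0.
move=> t t0 /ltW te; rewrite ler_pdivlMr ?powR_gt0//.
apply: (@le_trans _ _ ((`|a| + 1) * t `^ s)).
  by rewrite ler_wpM2r ?powR_ge0// (le_trans (ler_norm a))// lerDl.
rewrite mulrC -ler_pdivlMr// -[leRHS](powR_root (ltW ca0) s0).
by rewrite ge0_ler_powR ?nnegrE ?powR_ge0// ltW.
Qed.

Lemma continuous_powR p x : 0 < x -> {for x, continuous (fun t => t `^ p)}.
Proof.
move=> x0; apply: differentiable_continuous; apply/derivable1_diffP.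
by apply: derivable_powR; rewrite in_itv/= x0.
Qed.

End powers.

Lemma continuous_sum_at {R : realType} (T : topologicalType) (I : Type)
    (r : seq I) (P : pred I) (F : I -> T -> R) (t : T) :
  (forall i, P i -> {for t, continuous (F i)}) ->
  {for t, continuous (fun u => \sum_(i <- r | P i) F i u)}.
Proof. by move=> Fc; apply: cvg_big => //; exact: add_continuous. Qed.

(** * An empty shell *)

Section pigeonhole.
Context {R : realType}.

(** The N + 1 shells are disjoint, so if all were occupied, choosing an index in
    each would be an injection of 'I_N.+1 into itself, hence a bijection; but
    the index ord0 lies inside the innermost radius and is in no shell. *)
Lemma empty_shell N (f : 'I_N.+1 -> R) (rho : nat -> R) :
  {homo rho : k l / (k <= l)%N >-> k <= l} -> f ord0 <= rho 0%N ->
  exists2 k, (k <= N)%N & forall i, (f i <= rho k) || (rho k.+1 < f i).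
Proof.
move=> rho_mono f0; apply: contrapT => full.
have /choice[g gP] : forall k : 'I_N.+1,
    exists i, rho k < f i /\ f i <= rho k.+1.
  move=> k; apply: contrapT => empty; apply: full; exists k => [|i].
    by rewrite -ltnS.
  have [//|lt_rho] := leP (f i) (rho k); rewrite ltNge/=.
  by apply/negP => fi; apply: empty; exists i.
have g_inj : injective g.
  move=> k l gkl; apply/val_inj/eqP; rewrite eqn_leq; apply/andP.
  have [lk uk] := gP k; have [ll ul] := gP l; rewrite gkl in lk uk.
  split; rewrite leqNgt; apply/negP => /rho_mono lt.
    by have := le_lt_trans (le_trans ul lt) lk; rewrite ltxx.
  by have := le_lt_trans (le_trans uk lt) ll; rewrite ltxx.
have [h _ hK] := injF_bij g_inj.
have [+ _] := gP (h ord0); rewrite hK ltNge => /negP; apply.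
by rewrite (le_trans f0)// rho_mono.
Qed.

End pigeonhole.

(** * The Euclidean norm *)

Section eucl_norm_theory.
Context {R : realType} {d : nat}.
Implicit Types x : 'rV[R]_d.

Lemma eucl_norm_ge0 x : 0 <= eucl_norm x.
Proof. exact: sqrtr_ge0. Qed.

Lemma coord_le_eucl_norm x k : `|x 0 k| <= eucl_norm x.
Proof.
rewrite -sqrtr_sqr ler_sqrt ?sumr_ge0// => [|i _]; last exact: sqr_ge0.
by rewrite (bigD1 k)//= lerDl sumr_ge0// => i _; exact: sqr_ge0.
Qed.

Lemma eucl_norm_gt0 x : x != 0 -> 0 < eucl_norm x.
Proof.
move=> x0; rewrite lt_def eucl_norm_ge0 andbT; apply: contra_neq x0 => nx0.
apply/rowP => k; rewrite mxE; apply/eqP.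
by rewrite -normr_le0 -nx0 coord_le_eucl_norm.
Qed.

Lemma eucl_norm0 : eucl_norm (0 : 'rV[R]_d) = 0.
Proof.
rewrite /eucl_norm big1 ?sqrtr0// => k _.
by rewrite mxE expr0n.
Qed.

Lemma eucl_norm_axis (a : R) (k : 'I_d) : eucl_norm (a *: delta_mx 0 k) = `|a|.
Proof.
rewrite /eucl_norm (bigD1 k)//= !mxE !eqxx mulr1 big1 ?addr0 ?sqrtr_sqr//.
by move=> i ik; rewrite !mxE (negPf ik) andbF mulr0 expr0n.
Qed.

Lemma eucl_normN x : eucl_norm (- x) = eucl_norm x.
Proof. by congr Num.sqrt; apply: eq_bigr => k _; rewrite mxE sqrrN. Qed.

Lemma continuous_eucl_norm : continuous (@eucl_norm R d).
Proof.
move=> x; apply: (@continuous_comp _ _ _ _ (@Num.sqrt R)); last first.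
  exact: sqrt_continuous.
apply: continuous_sum_at => k _.
apply: (@continuous_comp _ _ _ (fun x : 'rV[R]_d => x 0 k) (fun t => t ^+ 2)).
  exact: coord_continuous.
exact: exprn_continuous.
Qed.

Lemma continuous_riesz (c q : R) x : x != 0 ->
  {for x, continuous (fun z => c / eucl_norm z `^ q)}.
Proof.
move=> /eucl_norm_gt0 x0.
apply: (@continuousM _ _ (fun=> c)); first exact: cst_continuous.
apply: continuousV; first by rewrite gt_eqF// powR_gt0.
apply: (@continuous_comp _ _ _ _ (fun t => t `^ q)).
  exact: continuous_eucl_norm.
exact: continuous_powR.
Qed.

End eucl_norm_theory.

(** * The energy and its restrictions *)

Section interaction_energy.
Context {R : realType} {d N : nat}.
Variables (p s : R) (m : 'I_N.+1 -> R).
Hypotheses (p_gt0 : 0 < p) (lt_ps : p < s) (m_gt0 : forall i, 0 < m i).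
Implicit Types (P : pred 'I_N.+1) (y : 'I_N.+1 -> 'rV[R]_d).

Let s_gt0 : 0 < s. Proof. exact: lt_trans lt_ps. Qed.

Definition repulsion y i j := m i * m j / eucl_norm (y i - y j) `^ s.

Definition attraction y i := m i / eucl_norm (y i) `^ p.

(** The energy of the subsystem of the points selected by P. Both sums keep the
    full range of indices and discard terms by a test, so that energies of
    different subsystems can be compared term by term. *)
Definition energy_on P y : R :=
  \sum_i \sum_(j | i != j) (if P i && P j then repulsion y i j else 0)
  - \sum_(i | i != ord0) (if P i then attraction y i else 0).

Lemma energyE y : injective y ->
  energy p s m y = (energy_on xpredT y)%:E.
Proof. by move=> /injectiveP yi; rewrite /energy yi. Qed.

Lemma mass_lower_bound : exists2 mu, 0 < mu & forall i, mu <= m i.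
Proof.
exists (m [arg min_(i < ord0) m i]%O) => // i.
by case: arg_minP => // j _; apply.
Qed.

Lemma repulsion_ge0 y i j : 0 <= repulsion y i j.
Proof. by rewrite divr_ge0 ?powR_ge0 ?mulr_ge0// ltW. Qed.

Lemma le_attraction y i r : 0 < r -> r <= eucl_norm (y i) ->
  attraction y i <= m i / r `^ p.
Proof. by move=> r0 ry; rewrite div_powR_le// ltW. Qed.

Lemma repulsion_row_le y i :
  \sum_(j | i != j) repulsion y i j <= \sum_i \sum_(j | i != j) repulsion y i j.
Proof.
rewrite [leRHS](bigD1 i)//= lerDl sumr_ge0// => k _.
by rewrite sumr_ge0// => j _; exact: repulsion_ge0.
Qed.

Lemma repulsion_le_row y i j : i != j ->
  repulsion y i j <= \sum_(j | i != j) repulsion y i j.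
Proof.
move=> ij; rewrite (bigD1 j)//= lerDl sumr_ge0// => k _.
exact: repulsion_ge0.
Qed.

Lemma sum_outside P (F : 'I_N.+1 -> R) : P ord0 ->
  \sum_(i | ~~ P i) F i = \sum_(i | i != ord0) (if ~~ P i then F i else 0).
Proof.
move=> P0; rewrite big_mkcond [RHS]big_mkcond; apply: eq_bigr => i _.
by case: eqVneq => [->|]; rewrite ?P0.
Qed.

(** The points outside P contribute nonnegative repulsion, and an attraction
    which is small when they are far from the origin. *)
Lemma energy_on_le P y r : P ord0 -> 0 < r ->
  (forall i, ~~ P i -> r <= eucl_norm (y i)) ->
  energy_on P y - \sum_(i | ~~ P i) m i / r `^ p <= energy_on xpredT y.
Proof.
move=> P0 r0 far; rewrite /energy_on -addrA -opprD lerB//.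
  apply: ler_sum => i _; apply: ler_sum => j _ /=.
  by case: ifP => // _; exact: repulsion_ge0.
rewrite (sum_outside _ P0) -big_split; apply: ler_sum => i _ /=.
have [Pi|Pi]/= := boolP (P i); first by rewrite addr0.
by rewrite add0r le_attraction// far.
Qed.

(** The heights on the k-th axis are distinct multiples of r. When ord0 is in P,
    those that are used are at least 2 * r, which leaves a distance r to the
    points of norm at most r. *)
Definition relocate (k : 'I_d) r P y i : 'rV[R]_d :=
  if P i then y i else (r * i.+1%:R) *: delta_mx 0 k.

Section relocation.
Variables (k : 'I_d) (r : R) (P : pred 'I_N.+1) (y : 'I_N.+1 -> 'rV[R]_d).
Hypotheses (r_gt0 : 0 < r) (P0 : P ord0).
Hypothesis near_le : forall i, P i -> eucl_norm (y i) <= r.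

Lemma relocate_norm_le i : eucl_norm (relocate k r P y i) <= N.+1%:R * r.
Proof.
rewrite /relocate; case: ifPn => [/near_le|_].
  by move=> /le_trans->//; rewrite ler_peMl ?ler1n// ltW.
rewrite eucl_norm_axis normrM normr_nat gtr0_norm// mulrC.
by rewrite ler_wpM2r ?(ltW r_gt0)// ler_nat ltn_ord.
Qed.

(** The k-th coordinates already differ by r, and each coordinate is a lower
    bound for the Euclidean norm. *)
Lemma relocate_separated i j : i != j -> ~~ (P i && P j) ->
  r <= eucl_norm (relocate k r P y i - relocate k r P y j).
Proof.
move=> ij PN; apply: le_trans (coord_le_eucl_norm _ k).
have coordE l : relocate k r P y l 0 k = if P l then y l 0 k else r * l.+1%:R.
  by rewrite /relocate; case: ifP => // _; rewrite !mxE !eqxx mulr1.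
have near_coord l : P l -> `|y l 0 k| <= r.
  by move=> /near_le; apply: le_trans; exact: coord_le_eucl_norm.
have far_coord l : ~~ P l -> r * 2 <= r * l.+1%:R.
  move=> Pl; rewrite ler_wpM2l ?(ltW r_gt0)// ler_nat ltnS lt0n.
  by apply: contraNneq Pl => l0; rewrite (_ : l = ord0)//; exact/val_inj.
rewrite mxE [X in _ + X]mxE !coordE.
have [Pi|Pi] := boolP (P i); have [Pj|Pj] := boolP (P j).
- by rewrite Pi Pj in PN.
- have := near_coord _ Pi; have := far_coord _ Pj; rewrite distrC ler_norml.
  by move=> fj /andP[_ ni]; apply: le_trans (ler_norm _); lra.
- have := near_coord _ Pj; have := far_coord _ Pi; rewrite ler_norml.
  by move=> fj /andP[_ ni]; apply: le_trans (ler_norm _); lra.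
rewrite -mulrBr normrM (gtr0_norm r_gt0) ler_peMr ?(ltW r_gt0)//.
have [lt_ij|lt_ji|/val_inj/eqP] := ltngtP i j; last by rewrite (negPf ij).
  rewrite distrC -natrB ?ltnS 1?ltnW// subSS normr_nat ler1n subn_gt0//.
by rewrite -natrB ?ltnS 1?ltnW// subSS normr_nat ler1n subn_gt0.
Qed.

Lemma relocate_inj : {in P &, injective y} -> injective (relocate k r P y).
Proof.
move=> yi i j eq_ij; apply: contrapT => /eqP ij.
have [/andP[Pi Pj]|PN] := boolP (P i && P j).
  by move: eq_ij; rewrite /relocate Pi Pj => /yi eqij; rewrite eqij ?eqxx in ij.
by have := relocate_separated ij PN; rewrite eq_ij subrr eucl_norm0 leNgt r_gt0.
Qed.

(** Each pair that involves a relocated point is at distance at least r; the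
    square of the total mass bounds the sum of m i * m j over those pairs. Each
    relocated point is at distance at most (N + 1) * r from the origin, which
    bounds its attraction from below. *)
Lemma energy_relocate_le :
  energy_on xpredT (relocate k r P y) <=
  energy_on P y + (\sum_i m i) ^+ 2 / r `^ s
  - \sum_(i | ~~ P i) m i / (N.+1%:R * r) `^ p.
Proof.
have attr : \sum_(i | i != ord0) (if P i then attraction y i else 0) +
    \sum_(i | ~~ P i) m i / (N.+1%:R * r) `^ p <=
    \sum_(i | i != ord0) attraction (relocate k r P y) i.
  rewrite (sum_outside _ P0) -big_split; apply: ler_sum => i i0 /=.
  have [Pi|Pi]/= := boolP (P i).
    by rewrite addr0 /attraction /relocate Pi.
  rewrite add0r div_powR_le ?relocate_norm_le ?ltW//.
  rewrite /relocate (negPf Pi) eucl_norm_axis normr_gt0.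
  by rewrite mulf_neq0 ?gt_eqF.
have rep : \sum_i \sum_(j | i != j) repulsion (relocate k r P y) i j <=
    \sum_i \sum_(j | i != j) (if P i && P j then repulsion y i j else 0) +
    (\sum_i m i) ^+ 2 / r `^ s.
  have -> : (\sum_i m i) ^+ 2 / r `^ s = \sum_i \sum_j m i * m j / r `^ s.
    rewrite expr2 mulr_suml mulr_suml; apply: eq_bigr => i _.
    by rewrite mulr_sumr mulr_suml.
  rewrite -big_split; apply: ler_sum => i _ /=.
  apply: (@le_trans _ _ (\sum_(j | i != j)
    ((if P i && P j then repulsion y i j else 0) + m i * m j / r `^ s))).
    apply: ler_sum => j ij.
    have [/andP[Pi Pj]|PN] := boolP (P i && P j).
      rewrite /repulsion /relocate Pi Pj lerDl divr_ge0 ?powR_ge0//.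
      by rewrite mulr_ge0// ltW.
    rewrite add0r div_powR_le ?mulr_ge0 ?relocate_separated//; exact: ltW.
  rewrite big_split lerD2l [leLHS]big_mkcond ler_sum// => j _.
  by case: ifP => // _; rewrite divr_ge0 ?powR_ge0 ?mulr_ge0// ltW.
rewrite {1}/energy_on /= lerBlDr (le_trans rep)// /energy_on.
by move: attr; lra.
Qed.

End relocation.

(** * Negative energy and descent to a bounded region *)

(** Beyond a certain scale, the repulsion created by a relocation costs at most
    half of the attraction gained by any single relocated point. *)
Lemma escape_radius : exists2 r0, 0 < r0 & forall r, r0 <= r ->
  forall i, (\sum_i m i) ^+ 2 / r `^ s <= m i / (N.+1%:R * r) `^ p / 2.
Proof.
have [mu mu0 mu_le] := mass_lower_bound.
have N0 : 0 < (N.+1%:R : R) `^ p by rewrite powR_gt0.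
have c0 : 0 < mu / N.+1%:R `^ p / 2 by rewrite !divr_gt0.
have [r0 r00 r0P] := slow_decay_dominates lt_ps (sqr_ge0 (\sum_i m i)) c0.
exists r0 => // r r0r i; apply: le_trans (r0P _ r0r) _.
have r_gt0 : 0 < r := lt_le_trans r00 r0r.
rewrite powRM ?(ltW r_gt0)// invfM mulrA.
rewrite [leRHS]mulrAC ler_wpM2r ?invr_ge0 ?powR_ge0//.
by rewrite ler_wpM2r// ler_wpM2r ?invr_ge0 ?powR_ge0.
Qed.

(** The origin alone has energy 0, and all the other points are relocated. *)
Lemma exists_energy_lt0 : (0 < d)%N -> (0 < N)%N ->
  exists y, [/\ y ord0 = 0, injective y & energy_on xpredT y < 0].
Proof.
move=> d0 N0; have [r r0 /(_ _ (lexx _))rP] := escape_radius.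
pose y0 (i : 'I_N.+1) : 'rV[R]_d := 0.
have near i : pred1 ord0 i -> eucl_norm (y0 i) <= r.
  by rewrite eucl_norm0 ltW.
exists (relocate (Ordinal d0) r (pred1 ord0) y0); split.
- by [].
- by apply: relocate_inj => // i j /eqP-> /eqP->.
apply: le_lt_trans (energy_relocate_le _ (P := pred1 ord0) r0 _ near) _ => //.
have -> : energy_on (pred1 ord0) y0 = 0.
  rewrite /energy_on big1 => [|i _].
    by rewrite big1 ?subrr// => i /negPf i0; rewrite /pred1 /= i0.
  rewrite big1// => j ij; rewrite /pred1 /=.
  case: ifPn => // /andP[/eqP i0 /eqP j0].
  by rewrite i0 j0 eqxx in ij.
rewrite add0r subr_lt0.
have max0 : ~~ pred1 ord0 (ord_max : 'I_N.+1).
  by rewrite /= -val_eqE /= -lt0n.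
apply: le_lt_trans (rP ord_max) _; rewrite (bigD1 ord_max)//=.
have term_gt0 i : 0 < m i / (N.+1%:R * r) `^ p.
  by rewrite divr_gt0 ?powR_gt0// mulr_gt0.
rewrite ltr_wpDr ?sumr_ge0//; last by have := term_gt0 ord_max; lra.
by move=> i _; exact/ltW/term_gt0.
Qed.

(** Some shell between consecutive radii r0 * b^k is empty, and relocating all
    the points beyond it does not raise the energy. *)
Lemma descent_to_bounded : (0 < d)%N ->
  exists D, forall y, y ord0 = 0 -> injective y ->
    exists y', [/\ y' ord0 = 0, injective y',
      forall i, eucl_norm (y' i) <= D &
      energy_on xpredT y' <= energy_on xpredT y].
Proof.
move=> d0; have [r0 r00 r0P] := escape_radius.
(* The ratio b satisfies (b * r)^p = 2 * ((N + 1) * r)^p: a point beyond the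
   empty shell has at most half of the attraction it has once relocated. *)
pose b := 2 `^ p^-1 * N.+1%:R : R.
have b1 : 1 <= b.
  rewrite -[1]mulr1 ler_pM ?ler1n//.
  by rewrite -[leLHS](powRr0 2) ler_powR ?ler1n// invr_ge0 ltW.
pose rho k := r0 * b ^+ k.
have rho_ge k : r0 <= rho k by rewrite ler_peMr ?(ltW r00)// exprn_ege1.
have rho_mono : {homo rho : k l / (k <= l)%N >-> k <= l}.
  by move=> k l kl; rewrite ler_pM2l// ler_weXn2l.
exists (N.+1%:R * rho N) => y y0 yi.
have [|k kN shell] := empty_shell (f := fun i => eucl_norm (y i)) rho_mono.
  by rewrite y0 eucl_norm0 (le_trans (ltW r00)).
pose r := rho k; pose P i := eucl_norm (y i) <= r.
have r_gt0 : 0 < r := lt_le_trans r00 (rho_ge k).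
have P0 : P ord0 by rewrite /P y0 eucl_norm0 ltW.
have far i : ~~ P i -> b * r <= eucl_norm (y i).
  move=> /negP Pi; have /orP[/Pi//|/ltW] := shell i.
  by rewrite /rho exprS mulrCA.
exists (relocate (Ordinal d0) r P y); split.
- by rewrite /relocate P0.
- by apply: relocate_inj => // i j _ _; exact: yi.
- move=> i; apply: le_trans (relocate_norm_le _ r_gt0 _ i) _ => //.
  by rewrite ler_pM2l// rho_mono.
have [[i0 Pi0]|allP] := pselect (exists i, ~~ P i); last first.
  have -> // : relocate (Ordinal d0) r P y = y.
  apply/funext => i; rewrite /relocate; case: ifPn => // Pi.
  by exfalso; apply: allP; exists i.
have br0 : 0 < b * r by rewrite mulr_gt0// (lt_le_trans ltr01).
have := energy_on_le P0 br0 far.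
have := energy_relocate_le (Ordinal d0) r_gt0 P0 (fun i => id).
have -> : \sum_(i | ~~ P i) m i / (b * r) `^ p =
    (\sum_(i | ~~ P i) m i / (N.+1%:R * r) `^ p) / 2.
  rewrite mulr_suml; apply: eq_bigr => i _.
  rewrite /b -mulrA powRM ?powR_ge0 ?(mulr_ge0 (ler0n _ _) (ltW r_gt0))//.
  by rewrite powR_root// invfM [2^-1 * _]mulrC mulrA.
(* A single point outside P is enough to pay for the repulsion. *)
have gain : (\sum_i m i) ^+ 2 / r `^ s <=
    (\sum_(i | ~~ P i) m i / (N.+1%:R * r) `^ p) / 2.
  apply: le_trans (r0P _ (rho_ge k) i0) _.
  rewrite ler_wpM2r// (bigD1 i0)//= lerDl sumr_ge0// => i _.
  by rewrite divr_ge0 ?powR_ge0// ltW.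
by move: gain; lra.
Qed.

(** * Separation, compactness and continuity *)

(** The total repulsion bounds both the repulsion of the pair (i, j) and that of
    the origin on all other points; averaging the two bounds, half of the latter
    absorbs the attraction up to a constant, which half of the former exceeds
    when i and j are close. *)
Lemma energy_lt0_separated : exists2 delta, 0 < delta &
  forall y, y ord0 = 0 -> injective y -> energy_on xpredT y < 0 ->
    forall i j, i != j -> delta <= eucl_norm (y i - y j).
Proof.
have [mu mu0 mu_le] := mass_lower_bound.
have m00 : 0 < m ord0 / 2 by rewrite divr_gt0.
have [C CP] := singular_control (ltW p_gt0) lt_ps m00.
have c0 : 0 < mu ^+ 2 / 2 by rewrite divr_gt0// exprn_gt0.
have [e e0 eP] := singular_unbounded ((\sum_(i | i != ord0) m i) * C) s_gt0 c0.
exists e => // y y0 yi yneg i j ij; rewrite leNgt; apply/negP => close.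
have dist_gt0 a b : a != b -> 0 < eucl_norm (y a - y b).
  move=> ab; apply: eucl_norm_gt0; rewrite subr_eq0.
  by apply: contra_neq ab => /yi.
have pair := eP _ (dist_gt0 _ _ ij) close.
have pair' : mu ^+ 2 / 2 / eucl_norm (y i - y j) `^ s <= repulsion y i j / 2.
  rewrite /repulsion [leRHS]mulrAC ler_wpM2r ?invr_ge0 ?powR_ge0// ler_wpM2r//.
  by rewrite expr2 ler_pM ?(ltW mu0).
have S1 := le_trans (repulsion_le_row y ij) (repulsion_row_le y i).
have S0 := repulsion_row_le y ord0.
have attr : \sum_(a | a != ord0) attraction y a <=
    (\sum_(j | ord0 != j) repulsion y ord0 j) / 2 +
    (\sum_(i | i != ord0) m i) * C.
  rewrite 2!mulr_suml [X in _ <= X + _](eq_bigl (fun a => a != ord0)); last first.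
    by move=> a; rewrite eq_sym.
  rewrite -big_split; apply: ler_sum => a a0 /=.
  have := CP _ (dist_gt0 _ _ a0); rewrite y0 subr0 => Ca.
  rewrite /attraction /repulsion y0 sub0r eucl_normN.
  have := ler_wpM2l (ltW (m_gt0 a)) Ca.
  by rewrite mulrDr [m ord0 * m a]mulrC -!mulrA [_^-1 / 2]mulrC.
by move: yneg; rewrite /energy_on/= ltNge => /negP; apply; lra.
Qed.

(** Stated along an arbitrary continuous family of configurations, so that the
    topology on the configurations need not be unfolded. *)
Lemma continuous_energy_on (T : topologicalType)
    (Y : T -> 'I_N.+1 -> 'rV[R]_d) (t : T) :
  (forall i, {for t, continuous (fun u => Y u i)}) ->
  Y t ord0 = 0 -> injective (Y t) ->
  {for t, continuous (fun u => energy_on xpredT (Y u))}.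
Proof.
move=> Yc Y0 Yi.
have term c q (u : T -> 'rV[R]_d) : {for t, continuous u} -> u t != 0 ->
    {for t, continuous (fun z => c / eucl_norm (u z) `^ q)}.
  by move=> uc ut; exact: (continuous_comp uc (continuous_riesz ut)).
apply: (@continuousB _ _ _ (fun u => \sum_i \sum_(j | i != j) repulsion (Y u) i j)
  (fun u => \sum_(i | i != ord0) attraction (Y u) i)).
  apply: continuous_sum_at => i _; apply: continuous_sum_at => j ij.
  apply: term; first exact: (continuousB (Yc i) (Yc j)).
  by rewrite subr_eq0; apply: contra_neq ij => /Yi.
apply: continuous_sum_at => i i0; apply: term; first exact: Yc.
by rewrite -Y0; apply: contra_neq i0 => /Yi.
Qed.

(** Configurations are typed by the product topology, for which Tychonoff's
    theorem applies. *)
Definition separated_in_ball (D delta : R) :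
    set (prod_topology (fun _ : 'I_N.+1 => 'rV[R]_d)) :=
  [set y | [/\ y ord0 = 0, forall i, eucl_norm (y i) <= D &
    forall i j, i != j -> delta <= eucl_norm (y i - y j)]].

Lemma compact_separated_in_ball D delta : compact (separated_in_ball D delta).
Proof.
pose X := prod_topology (fun _ : 'I_N.+1 => 'rV[R]_d).
have evalC i : continuous (fun z : X => z i).
  exact: (@proj_continuous _ (fun _ : 'I_N.+1 => 'rV[R]_d) i).
have cube : compact [set x : 'rV[R]_d | forall k, `[- D, D]%classic (x ord0 k)].
  by apply: (rV_compact (A := fun=> `[- D, D]%classic)) => k; exact: segment_compact.
have box := tychonoff (fun i : 'I_N.+1 => cube).
apply: subclosed_compact box _; last first.
  move=> y [_ bnd _] i k /=; rewrite in_itv/= -ler_norml.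
  exact: le_trans (coord_le_eucl_norm _ _) (bnd i).
rewrite (_ : separated_in_ball D delta = [set y : X | eucl_norm (y ord0) <= 0] `&`
   (\bigcap_i [set y : X | eucl_norm (y i) <= D]) `&`
   (\bigcap_(ij in [set ij | ij.1 != ij.2])
      [set y : X | delta <= eucl_norm (y ij.1 - y ij.2)])); last first.
  apply/seteqP; split => y /=.
    move=> [y0 bnd sep]; split; first split.
    - by rewrite y0 eucl_norm0.
    - by move=> i _; exact: bnd.
    - by move=> [i j] /= ij; exact: sep.
  move=> [[y0 bnd] sep]; split => [|i|i j ij].
  - by apply: contrapT => /eqP/eucl_norm_gt0; rewrite ltNge y0.
  - exact: bnd.
  - exact: (sep (i, j)).
have normC i : continuous (fun z : X => eucl_norm (z i)).
  by move=> z; exact: (continuous_comp (evalC i z) (@continuous_eucl_norm _ _ _)).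
apply: closedI; first apply: closedI.
- by apply: (@preimage_closed _ _ _ [set t : R | t <= 0]) => // z _; exact: normC.
- apply: closed_bigI => i _.
  by apply: (@preimage_closed _ _ _ [set t : R | t <= D]) => // z _; exact: normC.
apply: closed_bigI => -[i j] _ /=.
apply: (@preimage_closed _ _ (fun z : X => eucl_norm (z i - z j))
  [set t : R | delta <= t]) => // z _.
apply: (@continuous_comp _ _ _ (fun z : X => z i - z j)).
  exact: (continuousB (evalC i z) (evalC j z)).
exact: continuous_eucl_norm.
Qed.

End interaction_energy.

(** * Existence of a minimizer *)

Theorem proposition8 (R : realType) (d : nat) (p s : R) (N : nat)
    (m : 'I_N.+1 -> R)
    (hd : (2 <= d)%N) (hp : 0 < p) (hps : p < s) (hsd : s < d%:R)
    (hN : (1 <= N)%N) (hm : forall i, 0 < m i) :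
  (exists y : 'I_N.+1 -> 'rV[R]_d,
      @admissible R d N y /\ energy p s m y = min_energy d p s m) /\
  (min_energy d p s m < 0)%E.
Proof.
have d0 : (0 < d)%N by exact: ltnW.
pose E : ('I_N.+1 -> 'rV[R]_d) -> R := energy_on p s m xpredT.
have [D DP] := descent_to_bounded hp hps hm d0.
have [delta delta0 deltaP] := energy_lt0_separated (d := d) hp hps hm.
pose X := prod_topology (fun _ : 'I_N.+1 => 'rV[R]_d).
pose K : set X := separated_in_ball D delta.
have K_inj y : K y -> injective y.
  move=> [_ _ sep] i j eqy; apply: contrapT => /eqP /sep.
  by rewrite eqy subrr eucl_norm0 leNgt delta0.
have descent y : y ord0 = 0 -> injective y -> E y < 0 ->
    exists2 y', K y' & E y' <= E y.
  move=> y0 yi Ey; have [y' [y'0 y'i bnd le_E]] := DP y y0 yi.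
  exists y' => //; split=> //.
  by apply: deltaP => //; exact: le_lt_trans Ey.
have [z [z0 zi Ez]] := exists_energy_lt0 hp hps hm d0 hN.
have [w Kw Ewz] := descent z z0 zi Ez.
have [c cK cmin] : exists2 c, c \in K & forall y, y \in K -> E c <= E y.
  apply: (compact_EVT_min (T := X)); first by exists w.
    exact: compact_separated_in_ball.
  apply: continuous_in_subspaceT => y /set_mem Ky.
  apply: (@continuous_energy_on _ _ _ p s m X id y); last exact: K_inj.
    by move=> i; exact: (@proj_continuous _ (fun=> 'rV[R]_d) i).
  by case: Ky.
have {}cK := set_mem cK; have ci := K_inj _ cK.
have Ec : E c < 0.
  by apply: le_lt_trans Ez; apply: le_trans Ewz; apply: cmin; exact: mem_set.
have c_adm : admissible c by case: cK.
have -> : min_energy d p s m = (E c)%:E.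
  apply/le_anti/andP; split.
    by apply: ereal_inf_lbound; exists c => //; exact: energyE.
  apply: le_ereal_inf_tmp => _ [y y0 <-].
  have [yi|yni] := boolP (injectiveb y); last by rewrite /energy (negPf yni) leey.
  rewrite energyE ?lee_fin; last exact/injectiveP.
  have [Ey|Ey] := leP 0 (E y); first exact: le_trans (ltW Ec) Ey.
  have [y' Ky' le_y'] := descent y y0 (injectiveP _ yi) Ey.
  by apply: le_trans le_y'; apply: cmin; exact: mem_set.
split; last by rewrite lte_fin.
by exists c; split => //; exact: energyE.
Qed.
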